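(* Let $\phi\ge2$, let $\alpha>0$ be a real number, and let $\mathcal{I}$ be any $\phi$-smooth instance of scheduling on unrestricted related machines with $n$ jobs. Then \[ \Pr_{I\sim\mathcal{I}}\left[\max_{\sigma\in\mathrm{Lex}(I)\cup\mathrm{List}(I)}\frac{C_{\max}(I,\sigma)}{C^*_{\max}(I)}\ge\alpha\right]\le\left(\frac{32\phi}{2^{\alpha/6}}\right)^{n/2} \] and \[ \mathbb{E}_{I\sim\mathcal{I}}\left[\max_{\sigma\in\mathrm{Lex}(I)\cup\mathrm{List}(I)}\frac{C_{\max}(I,\sigma)}{C^*_{\max}(I)}\right]\le 18\log_2\phi+30 . \]
   Context: Scheduling on unrestricted related machines: machines $M=\{1,\dots,m\}$ with speeds $s_1\ge\dots\ge s_m=1$, jobs $J=\{1,\dots,n\}$ with processing requirements $p_j\ge0$; job $j$ on machine $i$ takes time $p_j/s_i$. A schedule $\sigma$ assigns each job to a machine; $J_i(\sigma)$ is the set of jobs on $i$, $L_i(\sigma)=\sum_{j\in J_i(\sigma)}p_j/s_i$, $C_{\max}(I,\sigma)=\max_iL_i(\sigma)$, and $C^*_{\max}(I)$ is the minimum makespan. $\sigma$ is lex-jump optimal if for every machine $i$, every job $j\in J_i(\sigma)$ and every machine $i'\ne i$: $L_{i'}(\sigma)+p_j/s_{i'}\ge L_i(\sigma)$; $\mathrm{Lex}(I)$ is the set of lex-jump optimal schedules. List scheduling takes an ordering of the jobs and, starting from the empty schedule, assigns the jobs one by one in this order, each to a machine $i$ minimizing (current load of $i$ from already assigned jobs) $+\,p_j/s_i$,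 ties broken arbitrarily; $\mathrm{List}(I)$ is the set of all schedules obtainable this way over all orderings and tie-breakings. A $\phi$-smooth instance $\mathcal{I}$ consists of a choice of $m$, speeds $s_1\ge\dots\ge s_m=1$, $n$, and for each job $j$ a density $f_j:[0,1]\to[0,\phi]$; the $p_j$ are drawn independently according to the $f_j$, yielding the random instance $I\sim\mathcal{I}$. *)

(* Defs.v *)
From HB Require Import structures.
From mathcomp Require Import all_boot all_order all_algebra.
From mathcomp Require Import all_classical all_reals all_analysis.

Set Implicit Arguments.
Unset Strict Implicit.
Unset Printing Implicit Defensive.
Import Order.TTheory GRing.Theory Num.Theory.
Import numFieldNormedType.Exports.

Local Open Scope classical_set_scope.
Local Open Scope ring_scope.

(* Machines are indexed by 'I_m.+1, so that there is at least one; jobs by    *)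
(* 'I_n. Index 0 is the fastest machine and ord_max the slowest.              *)

Notation schedule m n := {ffun 'I_n -> 'I_m.+1}.

Section Scheduling.
Context {R : realType} {m n : nat} (s : 'I_m.+1 -> R) (p : 'I_n -> R).
Implicit Types (sg : schedule m n) (i : 'I_m.+1) (j : 'I_n).

Definition load sg i : R := \sum_(j | sg j == i) p j / s i.

(* The seed 0 is neutral: loads are nonnegative when s and p are.             *)
Definition Cmax sg : R := \big[Num.max/0]_i load sg i.

(* The seed, the makespan of the schedule that puts every job on machine 0,   *)
(* is itself one of the values over which the minimum ranges.                 *)
Definition Copt : R :=
  \big[Num.min/Cmax [ffun => ord0]]_(sg : schedule m n) Cmax sg.

Definition Lex : set (schedule m n) :=
  [set sg : schedule m n | forall i j, sg j = i ->
     forall i', i' != i -> load sg i' + p j / s i' >= load sg i].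

Definition partial_load (t : {ffun 'I_n -> option 'I_m.+1}) i : R :=
  \sum_(j | t j == Some i) p j / s i.

(* [list_run o t]: assigning the jobs of o greedily, from left to right, may  *)
(* produce the partial schedule t (None = not yet assigned); the choice of i  *)
(* among the minimizers is free.                                              *)
Inductive list_run :
    seq 'I_n -> {ffun 'I_n -> option 'I_m.+1} -> Prop :=
| list_run_nil : list_run [::] [ffun => None]
| list_run_rcons o t j i :
    list_run o t ->
    (forall i', partial_load t i + p j / s i <=
                partial_load t i' + p j / s i') ->
    list_run (rcons o j) [ffun k => if k == j then Some i else t k].

Definition List : set (schedule m n) :=
  [set sg : schedule m n | exists o : seq 'I_n,
     perm_eq o (enum 'I_n) /\ list_run o [ffun j => Some (sg j)]].

(* The maximum of Cmax / Copt over Lex `|` List, a finite set, nonempty       *)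
(* because it contains every list schedule. The seed 0 is neutral because     *)
(* ratios are nonnegative. If all p j are 0, then Copt = 0 and the ratio is 0 *)
(* by convention; this event has probability 0 when n > 0.                    *)
Definition worst_ratio : R :=
  \big[Num.max/0]_(sg : schedule m n | sg \in Lex `|` List) (Cmax sg / Copt).

End Scheduling.

Section Smoothed.
Context {R : realType}.

Record smooth_instance (phi : R) (m n : nat) := SmoothInstance {
  speed : 'I_m.+1 -> R ;
  speed_noninc : forall i i' : 'I_m.+1, (i <= i')%N -> speed i' <= speed i ;
  speed_last : speed ord_max = 1 ;
  (* only the values on [0, 1] are relevant *)
  density : 'I_n -> R -> R ;
  density_meas : forall j, measurable_fun `[(0 : R), 1] (density j) ;
  density_bound : forall j (x : R), 0 <= x <= 1 -> 0 <= density j x <= phi ;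
  density_total : forall j,
    (\int[lebesgue_measure]_(x in `[(0 : R)%R, 1%R]) (density j x)%:E = 1)%E }.

Definition mutually_independent d (T : measurableType d)
    (P : probability T R) (n : nat) (X : 'I_n -> {RV P >-> R}) : Prop :=
  forall (J : {set 'I_n}) (A : 'I_n -> set R),
    (forall j, measurable (A j)) ->
    (P (\bigcap_(j in [set` J]) (X j @^-1` A j)) =
     \prod_(j in J) P (X j @^-1` A j))%E.

Definition has_density01 d (T : measurableType d) (P : probability T R)
    (X : {RV P >-> R}) (f : R -> R) : Prop :=
  forall A : set R, measurable A ->
    (distribution P X A =
     \int[lebesgue_measure]_(x in A `&` `[(0 : R)%R, 1%R]) (f x)%:E)%E.

(* The random processing requirements p are a realization of the instance I   *)
(* on the probability space (T, P).                                           *)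
Definition drawn_from (phi : R) (m n : nat) (I : smooth_instance phi m n)
    d (T : measurableType d) (P : probability T R)
    (p : 'I_n -> {RV P >-> R}) : Prop :=
  mutually_independent p /\ forall j, has_density01 (p j) (density I j).

End Smoothed.

Arguments drawn_from {R phi m n} I {d T} P p.

(* Main.v *)
(* Let C be the optimal makespan and let sg be a lex-jump optimal or list
   schedule with makespan at least a C. Call a machine t-busy if it and all
   faster machines have load at least t C in sg. A job that completes after
   (t + d) C in sg could have been put on the first machine that is not t-busy,
   so its size exceeds d C times the speed of every machine that is not t-busy.
   Comparing the volume of the jobs that complete late on the (t + 4)-busy
   machines with what an optimal schedule can process there within C, some such
   job is processed by the optimal schedule on a machine that is not
   (t + 4)-busy. Hence the speed bound for machines that are not t-busy halves
   each time t decreases by 4, starting from 1 / C because jobs have size at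
   most 1; for t >= 2 as small as possible it is about 2^-(a/4) / C. The
   t-busy machines carry volume at least 2 C times their total speed in sg, at
   most half of which can be processed on them in an optimal schedule; the rest
   consists of jobs of size at most about 2^-(a/4), and comparing volumes, at
   least half of all jobs are that small. A union bound over the sets of small
   jobs concludes, and summing the tail over a geometric series bounds the
   expectation. *)

Require Import Defs.
From mathcomp Require Import all_boot all_order all_algebra.
From mathcomp Require Import all_classical all_reals all_analysis.
From mathcomp Require Import measurable_realfun lra.

Import Order.TTheory GRing.Theory Num.Theory.
Import numFieldNormedType.Exports.
Local Open Scope classical_set_scope.
Local Open Scope ring_scope.

(** * Completion times in lex-jump optimal and list schedules *)

Section CompletionTimes.
Context {R : realType} {m n : nat} (s : 'I_m.+1 -> R) (p : 'I_n -> R).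
Hypotheses (s_gt0 : forall i, 0 < s i) (p_ge0 : forall j, 0 <= p j).
Implicit Types (t : {ffun 'I_n -> option 'I_m.+1}).
Implicit Types (sg : {ffun 'I_n -> 'I_m.+1}).

(* The common consequence of both optimality notions: c j is a completion time
   of job j that no move of j improves. Lex-jump optimality allows all jobs of
   a machine to complete at its load; in list scheduling, j completes when all
   jobs assigned earlier to its machine, and j itself, are processed. *)
Definition completion_times t (c : 'I_n -> R) : Prop :=
  (forall j i, t j != None -> c j <= partial_load s p t i + p j / s i) /\
  (forall i a, 0 <= a ->
     \sum_(j | (t j == Some i) && (c j <= a)) p j / s i <= a).

Lemma partial_load_Some sg i :
  partial_load s p [ffun j => Some (sg j)] i = load s p sg i.
Proof. by apply: eq_bigl => j; rewrite ffunE. Qed.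

Lemma list_run_unassigned o t j : list_run s p o t -> j \notin o -> t j = None.
Proof.
elim=> [|{}o {}t k i _ IH _]; first by rewrite ffunE.
rewrite mem_rcons inE negb_or ffunE => /andP[/negbTE -> jo]; exact: IH.
Qed.

Lemma time_ge0 j i : 0 <= p j / s i.
Proof. by rewrite divr_ge0 // ltW. Qed.

Lemma filtered_load_le t i (Q : pred 'I_n) :
  \sum_(j | (t j == Some i) && Q j) p j / s i <= partial_load s p t i.
Proof.
rewrite /partial_load [leRHS](bigID Q) lerDl sumr_ge0 // => j _.
exact: time_ge0.
Qed.

(** Induction on the run. The new job completes at the new load of its machine and satisfies the
    move inequality by greediness; loads only grow, so earlier jobs keep their completion times. *)
Lemma list_run_completion_times o t :
  list_run s p o t -> uniq o -> exists c, completion_times t c.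
Proof.
elim=> [_|{}o {}t k i run IH greedy].
  exists (fun=> 0); split=> [j i|i a a0]; first by rewrite ffunE.
  by rewrite big1 // => j; rewrite ffunE.
rewrite rcons_uniq => /andP[ko /IH[c [c_move c_sum]]].
have tk := list_run_unassigned _ _ _ run ko.
set t' := [ffun _ => _].
have loadE i' : partial_load s p t' i' =
    partial_load s p t i' + (if i' == i then p k / s i' else 0).
  rewrite /partial_load (bigID (pred1 k)) /= addrC; congr (_ + _).
    rewrite [RHS](bigID (pred1 k)) /= [X in _ = X + _]big1 ?add0r.
      by apply: eq_bigl => j; rewrite ffunE; case: (eqVneq j k); rewrite ?andbF.
    by move=> j /andP[/eqP tj /eqP jk]; move: tj; rewrite jk tk.
  case: eqVneq => [->|ii].
    rewrite (big_pred1 k) // => j; rewrite ffunE /=.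
    by case: (eqVneq j k); rewrite ?eqxx ?andbF.
  rewrite big1 // => j; rewrite ffunE.
  case: (eqVneq j k) => [_ /andP[/eqP[] e]|]; rewrite ?andbF //.
  by rewrite e eqxx in ii.
have load_le i' : partial_load s p t i' <= partial_load s p t' i'.
  by rewrite loadE lerDl; case: ifP => // _; apply: time_ge0.
exists (fun j => if j == k then partial_load s p t i + p k / s i else c j).
split=> [j i'|i' a a0].
  rewrite ffunE; case: (eqVneq j k) => [-> _|jk tj].
    by rewrite (le_trans (greedy i')) // lerD2r.
  by rewrite (le_trans (c_move _ i' tj)) // lerD2r.
(* If the new job completes by [a], the whole new load of [i] is at most [a]; otherwise the sum is
   the same as before the step. *)
have [/andP[/eqP ei le_a]|no] :=
    boolP ((i' == i) && (partial_load s p t i + p k / s i <= a)).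
  apply: le_trans le_a; apply: le_trans (filtered_load_le _ _ _) _.
  by rewrite loadE ei eqxx.
apply: le_trans (c_sum i' a a0); rewrite le_eqVlt; apply/orP; left; apply/eqP.
apply: eq_bigl => j; rewrite ffunE; case: (eqVneq j k) => // ->.
by rewrite tk /=; move: no; rewrite eq_sym => /negbTE.
Qed.

Lemma Lex_completion_times sg :
  Lex s p sg -> completion_times [ffun j => Some (sg j)] (load s p sg \o sg).
Proof.
move=> lex; split=> [j i _|i a a0].
  rewrite partial_load_Some /=; have [->|ne] := eqVneq i (sg j).
    by rewrite lerDl time_ge0.
  exact: lex.
(* All jobs of a machine complete at once, so the sum is the whole load or empty. *)
have [le_a|gt_a] := leP (load s p sg i) a.
  apply: le_trans le_a; rewrite -[leRHS]partial_load_Some.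
  exact: filtered_load_le.
rewrite big1 // => j; rewrite ffunE /= => /andP[/eqP[->]].
by rewrite leNgt gt_a.
Qed.

Lemma LexList_completion_times sg : (Lex s p `|` List s p) sg ->
  exists c, completion_times [ffun j => Some (sg j)] c.
Proof.
move=> [lex|[ord [perm run]]].
  by eexists; exact: Lex_completion_times lex.
by apply: list_run_completion_times run _; rewrite (perm_uniq perm) enum_uniq.
Qed.

End CompletionTimes.

(** * Deterministic core: slow idle machines and many small jobs *)

Section SpeedDoubling.
Context {R : realType} {m n : nat} (s : 'I_m.+1 -> R) (p : 'I_n -> R).
Hypotheses (s_gt0 : forall i, 0 < s i) (p_ge0 : forall j, 0 <= p j).
Hypothesis s_noninc : forall i i' : 'I_m.+1, (i <= i')%N -> s i' <= s i.
Implicit Types (sg : {ffun 'I_n -> 'I_m.+1}) (H : pred 'I_m.+1).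

Lemma volume_on_machine sg i : \sum_(j | sg j == i) p j = load s p sg i * s i.
Proof.
by rewrite mulr_suml; apply: eq_bigr => j _; rewrite divfK // gt_eqF.
Qed.

Lemma volume_on_machines sg H :
  \sum_(j | H (sg j)) p j = \sum_(i | H i) load s p sg i * s i.
Proof.
rewrite (partition_big sg H) //=; apply: eq_bigr => i Hi.
rewrite -volume_on_machine; apply: eq_bigl => j.
by case: eqVneq => [->|]; rewrite ?Hi ?andbF.
Qed.

Variables (C : R) (opt sg : {ffun 'I_n -> 'I_m.+1}) (c : 'I_n -> R).
Hypotheses (C_gt0 : 0 < C) (opt_load : forall i, load s p opt i <= C).
Hypothesis c_times : completion_times s p [ffun j => Some (sg j)] c.

Lemma opt_job_size j : p j <= C * s (opt j).
Proof.
rewrite -ler_pdivrMr //; apply: le_trans (opt_load (opt j)).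
rewrite /load (bigD1 j) //= lerDl sumr_ge0 // => k _.
by rewrite divr_ge0 // ltW.
Qed.

Lemma opt_volume H : \sum_(j | H (opt j)) p j <= C * \sum_(i | H i) s i.
Proof.
rewrite volume_on_machines mulr_sumr; apply: ler_sum => i _.
by rewrite ler_wpM2r // ltW.
Qed.

(** By the second clause of [completion_times], at most [x] of a machine's load belongs to jobs
    completing by time [x]; the rest is late. *)
Lemma late_volume H x : 0 <= x ->
  \sum_(i | H i) (load s p sg i - x) * s i <=
  \sum_(j | H (sg j) && (x < c j)) p j.
Proof.
move=> x0; rewrite (partition_big sg H) /=; last by move=> j /andP[].
apply: ler_sum => i Hi; rewrite -ler_pdivlMr //.
rewrite lerBlDl -lerBlDr /load (bigID (fun j => c j <= x)) /=.
rewrite -addrA; set A := \sum_(j | _ && (c j <= x)) _.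
have leA : A <= x.
  have := c_times.2 i x x0; congr (_ <= _).
  by apply: eq_bigl => j; rewrite ffunE.
set B := \sum_(j | _) _; suff -> : B =
    (\sum_(j | H (sg j) && (x < c j) && (sg j == i)) p j) / s i.
  by rewrite subrr addr0.
rewrite mulr_suml; apply: eq_bigl => j; rewrite -ltNge.
by case: eqVneq => [->|]; rewrite ?Hi ?andbF ?andbT.
Qed.

Lemma late_job i x : 0 <= x < load s p sg i -> exists2 j, sg j = i & x < c j.
Proof.
move=> /andP[x0 lt_x]; have := late_volume (pred1 i) x x0.
rewrite big_pred1_eq; have [/existsP[j /andP[/eqP ? ?]] _|] :=
  boolP [exists j, (sg j == i) && (x < c j)]; first by exists j.
rewrite negb_exists => /forallP no.
rewrite big1 => [|j]; last by move/negP: (no j).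
by rewrite leNgt mulr_gt0 // subr_gt0.
Qed.

(** Busy machines form an initial segment, so every machine outside it is no faster than some
    machine with load below [t * C]. *)
Definition busy (t : R) (i : 'I_m.+1) :=
  [forall i' : 'I_m.+1, (i' <= i)%N ==> (t * C <= load s p sg i')].

(** Some machine [b] at least as fast as [i] has load below [t * C]. Moving [j] to [b] does not let
    it complete before [c j], so its time on [b] exceeds [d * C]. *)
Lemma late_job_size (t d : R) i j :
  ~~ busy t i -> 0 <= d -> (t + d) * C < c j ->
  d * C * s i < p j.
Proof.
rewrite negb_forall => /existsP[b].
rewrite negb_imply -ltNge => /andP[bi Lb] d0 cj.
have dC : 0 <= d * C by rewrite mulr_ge0 // ltW.
apply: (@le_lt_trans _ _ (d * C * s b)); first by rewrite ler_wpM2l // s_noninc.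
rewrite -ltr_pdivlMr // -(ltrD2l (load s p sg b)).
have := c_times.1 j b; rewrite ffunE partial_load_Some => /(_ isT).
apply: lt_le_trans; apply: lt_trans cj; by rewrite mulrDl ltrD2r.
Qed.

Lemma busy_load t i : busy t i -> t * C <= load s p sg i.
Proof. by move=> /forallP/(_ i); rewrite leqnn. Qed.

Variables (a : R) (i0 : 'I_m.+1).
Hypothesis i0_load : a * C <= load s p sg i0.

(** Otherwise a job completing late on [i0] would have size above [C * s ord0], more than [opt] fits
    on any machine. *)
Lemma busy0 t : 0 <= t -> t < a - 1 -> busy t ord0.
Proof.
move=> t0 ta; apply/negPn/negP => /late_job_size small.
have tC : 0 <= (t + 1) * C < load s p sg i0.
  rewrite mulr_ge0 ?addr_ge0 // ?ltW //= (lt_le_trans _ i0_load) //.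
  by rewrite ltr_pM2r // -ltrBrDr.
have [j _ cj] := late_job i0 _ tC; have := small 1 j ler01 cj.
rewrite mul1r ltNge => /negP; apply; apply: le_trans (opt_job_size j) _.
by rewrite ler_wpM2l ?s_noninc // ltW.
Qed.

Hypothesis p_le1 : forall j, p j <= 1.

(** For [r = 0], a job on [i0] completing after [(a - 1) * C] has size above [C * s i] and at most
    1. Each induction step lowers the threshold by 4 and halves the bound. *)
Lemma idle_speed r i : 4 * r%:R + 4 <= a -> ~~ busy (a - 2 - 4 * r%:R) i ->
  C * s i <= 2 ^- r.
Proof.
elim: r i => [|r IH] i; rewrite ?mulr0 ?add0r ?subr0 => ra idle.
  have x0 : 0 <= (a - 1) * C < load s p sg i0.
    rewrite mulr_ge0 ?(ltW C_gt0) //=; last by lra.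
    by rewrite (lt_le_trans _ i0_load) // ltr_pM2r //; lra.
  have [j _ cj] := late_job i0 _ x0; rewrite expr0 invr1.
  apply: le_trans (p_le1 j); rewrite -[C]mul1r ltW //.
  by apply: late_job_size idle ler01 _; congr (_ * C < _): cj; lra.
rewrite -[r.+1%:R]natr1 in ra idle.
set t := a - 2 - 4 * (r%:R + 1) in idle; set H := busy (t + 4).
have r0 : 0 <= r%:R :> R := ler0n _ r.
have t2 : 0 <= t + 2 by rewrite /t; lra.
have Et : t + 4 = a - 2 - 4 * r%:R by rewrite /t; lra.
(* First case: a late job of an [H] machine runs outside [H] in [opt]. Its size is above
   [2 * C * s i] and, by induction, at most [2 ^- r]. *)
have [/existsP[j /and3P[Hj cj optj]]|no] :=
    boolP [exists j, [&& H (sg j), (t + 2) * C < c j & ~~ H (opt j)]].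
  have := late_job_size t 2 i j idle (ler0n _ 2) cj => small.
  rewrite exprS invfM.
  have IHj : C * s (opt j) <= 2 ^- r.
    by apply: IH; [lra|rewrite -Et].
  have := opt_job_size j; move: (2 ^- r) IHj => e; lra.
have S_gt0 : 0 < \sum_(i | H i) s i.
  rewrite (bigD1 ord0) /=; last by apply: busy0; rewrite Et; lra.
  by rewrite ltr_pwDl // sumr_ge0 // => k _; rewrite ltW.
have t2C : 0 <= (t + 2) * C by rewrite mulr_ge0 // ltW.
(* Second case: the late jobs of [H] stay in [H] under [opt]. Loads of at least [(t + 4) * C] make
   their volume at least [2 * C] times the speed sum, twice what [opt] can hold there. *)
suff : 2 * C * \sum_(i | H i) s i <= C * \sum_(i | H i) s i.
  by rewrite -mulrA ger_pMl ?mulr_gt0 // => ?; exfalso; lra.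
apply: le_trans (opt_volume H).
apply: (@le_trans _ _ (\sum_(i | H i) (load s p sg i - (t + 2) * C) * s i)).
  rewrite mulr_sumr; apply: ler_sum => k Hk.
  rewrite ler_wpM2r // ?(ltW (s_gt0 _)) //.
  by have := busy_load _ _ Hk; rewrite !mulrDl; lra.
apply: le_trans (late_volume H _ t2C) _.
rewrite [leRHS]big_mkcond [leLHS]big_mkcond; apply: ler_sum => j _.
have [/andP[Hj cj]|_] := ifP; last by case: ifP.
move: no; rewrite negb_exists => /forallP/(_ j).
by rewrite Hj cj /= negbK => ->.
Qed.

Lemma half_jobs_small r : 4 * r%:R + 4 <= a ->
  (n <= 2 * #|[set j | p j <= 2 ^- r]%R%SET|)%N.
Proof.
move=> ra; set t := a - 2 - 4 * r%:R; set H := busy t.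
set e := 2 ^- r; have e_gt0 : 0 < e by rewrite invr_gt0 exprn_gt0.
(* Here [t >= 2], so [sg] puts at least [2 * C] times the speed sum on [H] and [opt] at most half of
   that; hence [opt] has at least half of the total volume outside [H]. *)
have vol : \sum_(j | H (opt j)) p j <= \sum_(j | ~~ H (opt j)) p j.
  have le1 : \sum_(i | H i) (2 * C) * s i <= \sum_(j | H (sg j)) p j.
    rewrite volume_on_machines; apply: ler_sum => i Hi.
    rewrite ler_wpM2r // ?(ltW (s_gt0 _)) //.
    apply: le_trans (busy_load _ _ Hi).
    by rewrite ler_pM2r // /t; lra.
  have le2 : \sum_(j | H (sg j)) p j <= \sum_j p j.
    rewrite [leLHS]big_mkcond; apply: ler_sum => j _.
    by case: ifP.
  have le3 := opt_volume H.
  rewrite -mulr_sumr in le1.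
  by rewrite [leRHS](bigID (fun j => H (opt j))) /= in le2; lra.
have idle_small j : ~~ H (opt j) -> p j <= e.
  by move=> /(idle_speed r _ ra); apply: le_trans (opt_job_size j).
(* Jobs larger than [e] all run in [H] under [opt], and jobs outside [H] have size at most [e], so
   [vol] compares the two counts. *)
set small := [set j | _]%SET; suff : (#|~: small| <= #|small|)%N.
  rewrite mul2n -addnn -(leq_add2l #|small|); apply: leq_trans.
  by rewrite cardsC card_ord.
rewrite -(ler_nat R) -(ler_pM2l e_gt0).
have le1 : e * #|~: small|%:R <= \sum_(j | H (opt j)) p j.
  rewrite mulr_natr -sumr_const [leRHS]big_mkcond [leLHS]big_mkcond.
  apply: ler_sum => j _; rewrite !inE -ltNge.
  case: ifP => [lt_e|_]; last by case: ifP.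
  case: ifP => [_|/negbT/idle_small]; first exact: ltW.
  by rewrite leNgt lt_e.
have le2 : \sum_(j | ~~ H (opt j)) p j <= e * #|small|%:R.
  rewrite mulr_natr -sumr_const [leRHS]big_mkcond [leLHS]big_mkcond.
  apply: ler_sum => j _; rewrite inE.
  have [/idle_small le_e|_] := boolP (~~ H (opt j)); first
    by rewrite le_e.
  by case: ifP => // _; apply: ltW.
exact: le_trans le1 (le_trans vol le2).
Qed.

End SpeedDoubling.

(** * From a large worst ratio to many small jobs *)

Lemma bigmax_gt0_geP (R : realDomainType) (I : finType) (Q : pred I)
    (F : I -> R) a :
  0 < a -> a <= \big[Num.max/0]_(i | Q i) F i <-> exists2 i, Q i & a <= F i.
Proof.
move=> a0; split=> [|[i Qi le]]; last exact: bigmax_sup Qi le.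
move=> le; apply: contrapT => no.
suff : \big[Num.max/0]_(i | Q i) F i < a by rewrite ltNge le.
apply/bigmax_ltP; split=> // i Qi; rewrite ltNge; apply/negP => le_a.
by apply: no; exists i.
Qed.

Section WorstRatio.
Context {R : realType} {m n : nat} (s : 'I_m.+1 -> R).
Implicit Types (p : 'I_n -> R) (sg : {ffun 'I_n -> 'I_m.+1}).

Lemma Cmax_ge0 p sg : 0 <= Cmax s p sg.
Proof. exact: bigmax_ge_id. Qed.

Lemma Copt_attained p : exists sg, Copt s p = Cmax s p sg.
Proof.
rewrite /Copt; elim/big_ind: _ => [|x y [u ->] [v ->]|sg _].
- by exists [ffun => ord0].
- by rewrite minElt; case: ifP; [exists u | exists v].
- by exists sg.
Qed.

Lemma worst_ratio_ge0 p : 0 <= worst_ratio s p.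
Proof. exact: bigmax_ge_id. Qed.

(** Division-free form, used both to extract a bad schedule and to prove measurability. If [Copt] is
    0, all ratios are 0 by convention and stay below [a]. *)
Lemma worst_ratio_geP p a : 0 < a -> a <= worst_ratio s p <->
  exists sg, (Lex s p sg \/ List s p sg) /\
             (0 < Copt s p /\ a * Copt s p <= Cmax s p sg).
Proof.
move=> a0; rewrite /worst_ratio bigmax_gt0_geP //.
have : 0 <= Copt s p by have [sg ->] := Copt_attained p; exact: Cmax_ge0.
rewrite le_eqVlt => /predU1P[C0|C_gt0]; split.
- by case=> sg _; rewrite -C0 invr0 mulr0 leNgt a0.
- by case=> sg [_ []]; rewrite -C0 ltxx.
- by case=> sg /set_mem sgL; rewrite ler_pdivlMr //; exists sg.
- by case=> sg [sgL [_ le]]; exists sg; [exact: mem_set | rewrite ler_pdivlMr].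
Qed.

(** A positive ratio would require a positive [Copt], but without jobs all loads are empty sums. *)
Lemma worst_ratio_no_job p : n = 0%N -> worst_ratio s p = 0.
Proof.
move=> n0; apply/eqP; rewrite eq_le worst_ratio_ge0 andbT leNgt.
apply/negP => gt0.
have /(worst_ratio_geP _ _ gt0)[sg [_ [C_gt0 _]]] := lexx (worst_ratio s p).
have [opt Copt_opt] := Copt_attained p.
move: C_gt0; rewrite Copt_opt ltNge => /negP; apply.
apply/bigmax_leP; split=> // i _; rewrite /load big1 // => -[j jn].
by exfalso; rewrite n0 in jn.
Qed.

Hypothesis s_gt0 : forall i, 0 < s i.
Hypothesis s_noninc : forall i i' : 'I_m.+1, (i <= i')%N -> s i' <= s i.

Lemma worst_ratio_half_small p a : (forall j, 0 <= p j <= 1) -> 4 <= a ->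
  a <= worst_ratio s p ->
  (n <= 2 * #|[set j | p j <= 8 / 2 `^ (a / 6)]%R%SET|)%N.
Proof.
move=> p01 a4; have a0 : 0 < a by lra.
have p_ge0 j : 0 <= p j by case/andP: (p01 j).
have p_le1 j : p j <= 1 by case/andP: (p01 j).
move=> /(worst_ratio_geP _ _ a0)[sg [sgL [C_gt0 le_a]]].
have [opt Copt_opt] := Copt_attained p.
have opt_load i : load s p opt i <= Copt s p.
  by rewrite Copt_opt; apply: le_bigmax.
have [c c_times] := LexList_completion_times _ _ s_gt0 p_ge0 _ sgL.
have aC0 : 0 < a * Copt s p by rewrite mulr_gt0.
have [i0 _ i0_load] := (bigmax_gt0_geP _ _ _ _ _ aC0).1 le_a.
(* The largest [r] that [half_jobs_small] allows. It satisfies [r + 3 > a / 4 + 1 >= a / 6], which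
   gives [2 ^- r <= 8 / 2 ^ (a / 6)]. *)
pose r := Num.truncn ((a - 4) / 4).
have a4_ge0 : 0 <= (a - 4) / 4 by lra.
have /andP[r_le r_gt] := truncn_itv a4_ge0.
rewrite -/r in r_le r_gt.
rewrite -[r.+1%:R]natr1 in r_gt.
have ra : 4 * r%:R + 4 <= a by lra.
have := half_jobs_small _ _ s_gt0 p_ge0 s_noninc _ _ _ _ C_gt0 opt_load c_times
  _ _ i0_load p_le1 _ ra.
move/leq_trans; apply; rewrite leq_mul2l /=; apply: subset_leq_card.
apply/fintype.subsetP => j; rewrite !inE => /le_trans; apply.
rewrite ler_pdivlMr ?powR_gt0 // mulrC ler_pdivrMr ?exprn_gt0 //.
have -> : 8 * 2 ^+ r = 2 `^ (3 + r%:R) :> R.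
  rewrite powRD; last by rewrite pnatr_eq0 implybT.
  by rewrite !powR_mulrn ?ler0n // -[2 ^+ 3]natrX.
have r0 : 0 <= r%:R :> R := ler0n _ r.
apply: ler_powR; [exact: ler1n | lra].
Qed.

End WorstRatio.

(** * Closure properties of measurable sets and functions *)

Section MeasurableSets.
Context {R : realType} {d} {T : measurableType d}.

Lemma measurable_le_set (f g : T -> R) : measurable_fun setT f ->
  measurable_fun setT g -> measurable [set w | f w <= g w].
Proof.
move=> mf mg; rewrite (_ : [set _ | _] =
  setT `&` (fun w => f w <= g w) @^-1` [set true]); last by rewrite setTI.
exact: measurable_fun_ler.
Qed.

Lemma measurable_lt_set (f g : T -> R) : measurable_fun setT f ->
  measurable_fun setT g -> measurable [set w | f w < g w].
Proof.
move=> mf mg; rewrite (_ : [set _ | _] =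
  setT `&` (fun w => f w < g w) @^-1` [set true]); last by rewrite setTI.
exact: measurable_fun_ltr.
Qed.

Lemma measurable_forall (I : finType) (A : I -> set T) :
  (forall i, measurable (A i)) -> measurable [set w | forall i, A i w].
Proof.
move=> mA; rewrite (_ : [set _ | _] = \bigcap_i A i).
  exact: fin_bigcap_measurable.
by apply/seteqP; split=> w h i //; exact: h.
Qed.

(** Countable rather than finite, because [List] quantifies over sequences of jobs. *)
Lemma measurable_exists (I : countType) (A : I -> set T) :
  (forall i, measurable (A i)) -> measurable [set w | exists i, A i w].
Proof.
move=> mA; rewrite (_ : [set _ | _] = \bigcup_i A i).
  by apply: countable_bigcupT_measurable => //; exact: countableP.
by apply/seteqP; split=> w [i]; exists i.
Qed.

Lemma measurable_imply (b : Prop) (A : set T) :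
  measurable A -> measurable [set w | b -> A w].
Proof.
move=> mA; have [hb|nb] := pselect b.
  rewrite (_ : [set _ | _] = A) //.
  by apply/seteqP; split=> w; [exact | move=> ? _].
by rewrite (_ : [set _ | _] = setT) //; apply/seteqP; split=> // w _ /nb.
Qed.

Lemma measurable_conj (b : Prop) (A : set T) :
  measurable A -> measurable [set w | b /\ A w].
Proof.
move=> mA; have [hb|nb] := pselect b.
  by rewrite (_ : [set _ | _] = A) //; apply/seteqP; split=> w; [case | split].
by rewrite (_ : [set _ | _] = set0) //; apply/seteqP; split=> // w [/nb].
Qed.

Lemma measurable_bigop (I : Type) (op : R -> R -> R) (x0 : T -> R) (r : seq I)
    (Q : pred I) (F : I -> T -> R) :
  (forall f g : T -> R, measurable_fun setT f -> measurable_fun setT g ->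
     measurable_fun setT (fun w => op (f w) (g w))) ->
  measurable_fun setT x0 -> (forall i, measurable_fun setT (F i)) ->
  measurable_fun setT (fun w => \big[op/x0 w]_(i <- r | Q i) F i w).
Proof.
move=> mop m0 mF; elim: r => [|i r IH].
  by under eq_fun do rewrite big_nil.
under eq_fun do rewrite big_cons.
by case: (Q i) => //; apply: mop.
Qed.

End MeasurableSets.

(** * Measurability of the worst ratio *)

Section WorstRatioMeasurable.
Context {R : realType} {m n : nat} (s : 'I_m.+1 -> R).
Context {d} {T : measurableType d} (p : 'I_n -> T -> R).
Hypothesis p_meas : forall j, measurable_fun setT (p j).
Local Notation "'pw' w" := (fun j => p j w) (at level 10).

Lemma measurable_time i j : measurable_fun setT (fun w => p j w / s i).
Proof. by apply: measurable_funM => //; exact: measurable_cst. Qed.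

Lemma measurable_load sg i : measurable_fun setT (fun w => load s (pw w) sg i).
Proof.
apply: (measurable_bigop _ _ (cst 0)) => [f g|//|j].
  exact: measurable_funD.
exact: measurable_time.
Qed.

Lemma measurable_partial_load t i :
  measurable_fun setT (fun w => partial_load s (pw w) t i).
Proof.
apply: (measurable_bigop _ _ (cst 0)) => [f g|//|j].
  exact: measurable_funD.
exact: measurable_time.
Qed.

Lemma measurable_Cmax sg : measurable_fun setT (fun w => Cmax s (pw w) sg).
Proof.
apply: (measurable_bigop _ _ (cst 0)) => [f g|//|i]; last exact: measurable_load.
exact: measurable_maxr.
Qed.

Lemma measurable_Copt : measurable_fun setT (fun w => Copt s (pw w)).
Proof.
apply: measurable_bigop => [f g||sg]; [|exact: measurable_Cmax..].
exact: measurable_minr.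
Qed.

Lemma measurable_Lex sg : measurable [set w | Lex s (pw w) sg].
Proof.
apply: measurable_forall => i; apply: measurable_forall => j.
apply: measurable_imply; apply: measurable_forall => i'; apply: measurable_imply.
apply: measurable_le_set; first exact: measurable_load.
by apply: measurable_funD; [exact: measurable_load | exact: measurable_time].
Qed.

(** Unfolds a run into finite quantifiers and inequalities between loads, so that measurability
    follows by induction on the job order. *)
Lemma list_run_rconsP (q : 'I_n -> R) o j t : list_run s q (rcons o j) t <->
  exists (t' : {ffun 'I_n -> option 'I_m.+1}) i,
    t = [ffun k => if k == j then Some i else t' k] /\
    (list_run s q o t' /\ forall i', partial_load s q t' i + q j / s i <=
                                     partial_load s q t' i' + q j / s i').
Proof.
split=> [run|[t' [i [-> [run greedy]]]]]; last exact: list_run_rcons.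
inversion run as [e|o' t' j' i run' greedy e].
  by move/(congr1 size): e; rewrite size_rcons.
by move/rcons_inj: e => [<- <-]; exists t', i.
Qed.

Lemma measurable_list_run o t : measurable [set w | list_run s (pw w) o t].
Proof.
elim/last_ind: o t => [|o j IH] t.
  have [->|ne] := pselect (t = [ffun => None]).
    rewrite (_ : [set _ | _] = setT) //; apply/seteqP; split=> // w _.
    exact: list_run_nil.
  rewrite (_ : [set _ | _] = set0) //; apply/seteqP; split=> // w run.
  apply: ne; inversion run as [|o' t' j' i _ _ e] => //.
  by move/(congr1 size): e; rewrite size_rcons.
under eq_set do rewrite (propext (list_run_rconsP _ _ _ _)).
apply: measurable_exists => t'; apply: measurable_exists => i.
apply: measurable_conj; apply: measurableI; first exact: IH.
apply: measurable_forall => i'; apply: measurable_le_set; apply: measurable_funD;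
  by [exact: measurable_partial_load | exact: measurable_time].
Qed.

Lemma measurable_List sg : measurable [set w | List s (pw w) sg].
Proof.
apply: measurable_exists => o; apply: measurable_conj; exact: measurable_list_run.
Qed.

Lemma measurable_worst_ratio_ge a :
  measurable [set w | a <= worst_ratio s (pw w)].
Proof.
have [a0|a0] := leP a 0.
  rewrite (_ : [set _ | _] = setT) //; apply/seteqP; split=> // w _ /=.
  exact: le_trans a0 (worst_ratio_ge0 _ _).
under eq_set do rewrite (propext (worst_ratio_geP _ _ _ a0)).
apply: measurable_exists => sg.
apply: measurableI.
  by apply: measurableU; [exact: measurable_Lex | exact: measurable_List].
apply: measurableI.
  by apply: measurable_lt_set; [exact: measurable_cst | exact: measurable_Copt].
apply: measurable_le_set; last exact: measurable_Cmax.
by apply: measurable_funM; [exact: measurable_cst | exact: measurable_Copt].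
Qed.

Lemma measurable_worst_ratio :
  measurable_fun setT (fun w => worst_ratio s (pw w)).
Proof.
apply: (measurability (@RGenCInfty.G R)) => [|_ [_ [a ->] <-]].
  exact: RGenCInfty.measurableE.
rewrite setTI preimage_itvcy; exact: measurable_worst_ratio_ge.
Qed.

End WorstRatioMeasurable.

(** * Union bound, bounded densities, independence and expectation *)

Section Measures.
Context {R : realType} {d} {T : measurableType d}.

Lemma measure_union_le (mu : {measure set T -> \bar R}) (I : finType)
    (Q : pred I) (A : I -> set T) : (forall i, measurable (A i)) ->
  (mu [set w | exists2 i, Q i & A i w] <= \sum_(i | Q i) mu (A i))%E.
Proof.
move=> mA.
have -> : [set w | exists2 i, Q i & A i w] = \big[setU/set0]_(i | Q i) A i.
  exact: (bigcup_pred Q A).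
have : measurable (\big[setU/set0]_(i | Q i) A i) /\
       (mu (\big[setU/set0]_(i | Q i) A i) <= \sum_(i | Q i) mu (A i))%E.
  elim/big_ind2: _ => [|a x b y [ma le_a] [mb le_b]|i _].
  - by rewrite measure0.
  - split; first exact: measurableU.
    by apply: le_trans (measureU2 _ ma mb) _; apply: leeD.
  - by [].
by case.
Qed.

Context (P : probability T R).

Lemma density01_tail (X : {RV P >-> R}) f (phi e : R) :
  has_density01 X f -> measurable_fun `[(0 : R), 1] f ->
  (forall x, 0 <= x <= 1 -> 0 <= f x <= phi) -> 0 <= e ->
  (P (X @^-1` `]-oo, e]) <= (phi * e)%:E)%E.
Proof.
move=> dens mf f_bound e0.
rewrite [leLHS](dens `]-oo, e]%classic (measurable_itv _)).
have phi0 : 0 <= phi.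
  have /andP[f0 f1] := f_bound 0 (introT andP (conj (lexx 0) ler01)).
  exact: le_trans f0 f1.
have mE : measurable (`]-oo, e] `&` `[(0 : R), 1]) by exact: measurableI.
have le_cst := ge0_le_integral lebesgue_measure mE
  (f1 := fun x => (f x)%:E) (f2 := cst phi%:E).
refine (le_trans (le_cst _ _ _ _) _).
- by move=> x [_]; rewrite /= in_itv /= => /f_bound/andP[f0 _]; rewrite lee_fin.
- apply/measurable_EFinP; apply: measurable_funS mf => //.
- exact: measurable_cst.
- by move=> x [_]; rewrite /= in_itv /= => /f_bound/andP[_ f1]; rewrite lee_fin.
rewrite integral_cst // EFinM lee_wpmul2l // ?lee_fin //.
(* Enlarging the domain to [[0, e]] covers [e > 1] as well. *)
apply: (@le_trans _ _ (lebesgue_measure `[(0 : R), e]%classic)).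
  apply: le_measure; rewrite ?inE //.
  by move=> x [] /=; rewrite !in_itv /= => -> /andP[->].
rewrite lebesgue_measure_itv /= lte_fin.
by case: ifP; rewrite ?sube0 // lee_fin.
Qed.

(** The random variables take values in all of [R]; this makes the outcomes with a size outside
    [[0, 1]] negligible. *)
Lemma density01_support (X : {RV P >-> R}) f : has_density01 X f ->
  P (X @^-1` ~` `[0, 1]) = 0%E.
Proof.
move=> dens; rewrite [LHS](dens (~` `[0, 1])); last exact: measurableC.
by rewrite setICl integral_set0.
Qed.

Lemma independent_all_le (n : nat) (X : 'I_n -> {RV P >-> R})
    (J : {set 'I_n}) (e q : R) :
  mutually_independent X -> 0 <= q ->
  (forall j, (P (X j @^-1` `]-oo, e]) <= q%:E)%E) ->
  (P [set w | forall j, j \in J -> (X j w <= e)%R] <= (q ^+ #|J|)%:E)%E.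
Proof.
move=> indep q0 le_q.
have indepJ := indep J (fun=> `]-oo, e]%classic) (fun=> measurable_itv _).
have -> : [set w | forall j, j \in J -> (X j w <= e)%R] =
    \bigcap_(j in [set` J]) (X j @^-1` `]-oo, e]).
  by apply/seteqP; split=> w h j /h; rewrite /= in_itv.
rewrite indepJ -prodr_const.
have : (0 <= \prod_(j in J) P (X j @^-1` `]-oo, e]))%E /\
   (\prod_(j in J) P (X j @^-1` `]-oo, e]) <= (\prod_(j in J) q)%:E)%E.
  elim/big_ind2: _ => [|a x b y [a0 ax] [b0 bx]|j _]; first by rewrite lee_fin.
  - by rewrite mule_ge0 // EFinM lee_pmul.
  - by [].
by case.
Qed.

(** Pointwise, [X] is at most [t] plus the number of [k] with [t + k <= X]; integrating termwise
    leaves a geometric series. *)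
Lemma geometric_tail_expectation (X : T -> R) (t q : R) :
  measurable_fun setT X -> (forall w, 0 <= X w) -> 0 <= t -> 0 < q < 1 ->
  (forall k, (P [set w | (t + k%:R <= X w)%R] <= (q ^+ k)%:E)%E) ->
  ('E_P[X] <= (t + (1 - q)^-1)%:E)%E.
Proof.
move=> mX X0 t0 /andP[q0 q1] tail; rewrite unlock.
pose A k := [set w | t + k%:R <= X w].
have mA k : measurable (A k).
  by apply: measurable_le_set => //; exact: measurable_cst.
have ind0 k w : (0 <= (\1_(A k) w)%:E :> \bar R)%E by rewrite lee_fin.
have mind k : measurable_fun setT (fun w => (\1_(A k) w)%:E : \bar R).
  by apply/measurable_EFinP; exact: measurable_indic.
have msum : measurable_fun setT
    (fun w => \sum_(0 <= k <oo) (\1_(A k) w)%:E : \bar R)%E.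
  by apply: ge0_emeasurable_sum => // k w _ _; exact: ind0.
apply: (@le_trans _ _
    (\int[P]_w (cst t%:E w + \sum_(0 <= k <oo) (\1_(A k) w)%:E))%E).
  apply: ge0_le_integral => //.
  - by move=> w _; rewrite lee_fin.
  - exact/measurable_EFinP.
  - by apply: emeasurable_funD => //; exact: measurable_cst.
  - move=> w _; have [Xt|tX] := leP (X w) t.
      apply: (@le_trans _ _ t%:E); first by rewrite lee_fin.
      by rewrite leeDl // nneseries_ge0.
    have Xt0 : 0 <= X w - t by rewrite subr_ge0 ltW.
    (* The first [N] indicators are all 1, and [X w - t < N]. *)
    pose N := (Num.truncn (X w - t)).+1.
    have /andP[N_le N_gt] := truncn_itv Xt0.
    apply: (@le_trans _ _ (t%:E + \sum_(0 <= k < N) (\1_(A k) w)%:E)%E);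
      last first.
      by rewrite leeD2l // nneseries_lim_ge.
    rewrite big_nat (eq_bigr (fun=> 1%:E)) => [|k /andP[_ kN]].
      rewrite -big_nat sumEFin lee_fin big_const_nat iter_addr subn0 addr0.
      by rewrite -lerBlDl ltW.
    rewrite indicE mem_set //= /A /= -lerBrDl (le_trans _ N_le) // ler_nat.
    by rewrite -ltnS.
rewrite ge0_integralD //; last by move=> w _; rewrite nneseries_ge0.
rewrite integral_cst // [X in (_ * X)%E](_ : _ = 1%E);
  last exact: probability_setT.
rewrite mule1 EFinD leeD2l //.
rewrite integral_nneseries //.
apply: lime_le; first by apply: is_cvg_nneseries => k _ _; rewrite integral_ge0.
apply: nearW => N; have q1' : `|q| < 1 by rewrite ger0_norm // ltW.
have := geometric_le_lim N (@ler01 R) q0 q1'; rewrite mul1r -lee_fin.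
apply: le_trans; rewrite /series /= -sumEFin; apply: lee_sum => k _.
by rewrite integral_indic // setIT mul1r tail.
Qed.

End Measures.

(** * The tail bound with integer exponent *)

Section Smoothed.
Context {R : realType} {phi : R} {m n : nat} (I : smooth_instance phi m n).
Context {d} {T : measurableType d} (P : probability T R).
Context (p : 'I_n -> {RV P >-> R}).
Hypotheses (hphi : 2 <= phi) (hp : drawn_from I P p).
Local Notation ratio w := (worst_ratio (speed I) (fun j => p j w)).

Lemma speed_gt0 i : 0 < speed I i.
Proof.
have /(speed_noninc I) : (i <= (ord_max : 'I_m.+1))%N by rewrite leq_ord.
by apply: lt_le_trans; rewrite speed_last.
Qed.

(** Outside a null set, some set of at least [uphalf n] jobs has all sizes at most [e]. Each such
    set has probability at most [(y / 4) ^+ uphalf n], and there are at most [2 ^ n] of them. *)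
Lemma worst_ratio_tail a : 0 <= a -> 32 * phi / 2 `^ (a / 6) <= 1 ->
  (P [set w | (a <= ratio w)%R] <=
   ((32 * phi / 2 `^ (a / 6)) ^+ uphalf n)%:E)%E.
Proof.
have phi2 := hphi.
move=> a0; set pw := 2 `^ (a / 6); set y := 32 * phi / pw => y1.
have pw_gt0 : 0 < pw by apply: powR_gt0.
(* For [a < 4] the denominator is at most 2, and the base would exceed 1. *)
have a4 : 4 <= a.
  rewrite leNgt; apply/negP => a4; move: y1; rewrite leNgt => /negP; apply.
  rewrite ltr_pdivlMr // mul1r.
  have : pw <= 2 `^ 1 by apply: ler_powR; [exact: ler1n | lra].
  by rewrite powRr1 // => pw2; lra.
set e := 8 / pw; have e0 : 0 <= e by rewrite divr_ge0 // ltW.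
have yE : phi * e = y / 4 by rewrite /y /e; lra.
pose Z j := p j @^-1` (~` `[0, 1]).
pose S (J : {set 'I_n}) := [set w | forall j, j \in J -> p j w <= e].
have mZ j : measurable (Z j).
  by rewrite -[Z j]setTI; apply: measurable_funPT => //; exact: measurableC.
have mS J : measurable (S J).
  apply: measurable_forall => j; apply: measurable_imply.
  exact: measurable_le_set.
pose Z' := [set w | exists2 j, xpredT j & Z j w].
pose S' := [set w | exists2 J : {set 'I_n}, (uphalf n <= #|J|)%N & S J w].
have mZ' : measurable Z'.
  rewrite (_ : Z' = [set w | exists j, Z j w]); first exact: measurable_exists.
  by apply/seteqP; split=> w [j]; exists j.
have mS' : measurable S'.
  rewrite (_ : S' = [set w | exists J : {set 'I_n},
      (uphalf n <= #|J|)%N /\ S J w]).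
    by apply: measurable_exists => J; apply: measurable_conj.
  by apply/seteqP; split=> w [J]; [exists J | case; exists J].
apply: (@le_trans _ _ (P (Z' `|` S'))).
  apply: le_measure; rewrite ?inE; [|exact: measurableU|].
    exact: measurable_worst_ratio_ge.
  move=> w /= le_ratio; have [wZ|wZ] := pselect (Z' w); [by left|right].
  have p01 j : 0 <= p j w <= 1.
    by apply: contrapT => out; apply: wZ; exists j.
  exists [set j | p j w <= e]%R%SET.
    rewrite leq_uphalf_double -mul2n.
    exact: (worst_ratio_half_small _ speed_gt0 (speed_noninc I)
              _ _ p01 a4 le_ratio).
  by move=> j; rewrite inE.
apply: le_trans (measureU2 _ mZ' mS') _.
rewrite [X in (X + _)%E](_ : _ = 0%E); last first.
  apply/eqP; rewrite eq_le measure_ge0 andbT.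
  apply: le_trans (measure_union_le _ _ _ _ mZ) _.
  by rewrite big1 // => j _; apply: density01_support (hp.2 j).
rewrite add0e; apply: le_trans (measure_union_le _ _ _ _ mS) _.
have y0 : 0 <= y by rewrite divr_ge0 // ?ltW // mulr_gt0 //; lra.
apply: (@le_trans _ _ (\sum_(J : {set 'I_n}) ((y / 4) ^+ uphalf n)%:E)%E).
  rewrite [leLHS]big_mkcond; apply: lee_sum => J _.
  case: ifP => [le_J|_]; last by rewrite lee_fin exprn_ge0 // divr_ge0.
  apply: le_trans (independent_all_le _ _ _ _ _ (y / 4) hp.1 _ _) _.
  - by rewrite divr_ge0.
  - move=> j; rewrite -yE.
    apply: density01_tail (hp.2 j) (density_meas I j) _ e0.
    exact: density_bound.
  by rewrite lee_fin ler_wiXn2l //; lra.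
rewrite sumEFin lee_fin sumr_const.
have -> : #|{: {set 'I_n}}| = (2 ^ n)%N.
  by have := card_powerset [set: 'I_n]%SET; rewrite powersetT !cardsT card_ord.
rewrite expr_div_n -[leLHS]mulr_natr -mulrA ler_piMr ?exprn_ge0 //.
rewrite mulrC ler_pdivrMr ?exprn_gt0 // mul1r natrX.
(* The number of sets is absorbed by [2 ^ n <= 4 ^ uphalf n]. *)
rewrite (_ : 4 = 2 ^+ 2); last by rewrite -natrX.
by rewrite -exprM ler_weXn2l ?ler1n // mul2n -leq_uphalf_double.
Qed.

End Smoothed.

(** * Real exponent [n / 2] and the expectation *)

Theorem theorem5 (R : realType) (phi alpha : R) (hphi : 2 <= phi)
    (halpha : 0 < alpha) (m n : nat) (I : smooth_instance phi m n)
    (d : measure_display) (T : measurableType d) (P : probability T R)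
    (p : 'I_n -> {RV P >-> R}) (hp : drawn_from I P p) :
  (P [set w | worst_ratio (speed I) (fun j => p j w) >= alpha]%R <=
     ((((32 * phi) / (2 `^ (alpha / 6))) `^ (n%:R / 2))%R)%:E)%E /\
  ('E_P[fun w => worst_ratio (speed I) (fun j => p j w)] <=
     (18 * (ln phi / ln 2) + 30)%R%:E)%E.
Proof.
have phi_gt0 : 0 < phi by lra.
have pm j : measurable_fun setT (p j) by [].
split.
  set y := 32 * phi / _.
  have y_gt0 : 0 < y by rewrite divr_gt0 ?powR_gt0 ?mulr_gt0.
  (* For a base of at most 1, raising the exponent from [n / 2] to [uphalf n] only decreases the
     power; for a larger base the bound exceeds 1. *)
  have [y_le1|y_gt1] := leP y 1.
    apply: le_trans (worst_ratio_tail _ _ _ hphi hp _ (ltW halpha) y_le1) _.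
    rewrite lee_fin -/y -powR_mulrn ?(ltW y_gt0) // ger_powR ?y_gt0 //.
    rewrite ler_pdivrMr // -natrM ler_nat muln2.
    by rewrite -leq_uphalf_double.
  apply: le_trans (probability_le1 P (measurable_worst_ratio_ge _ _ pm _)) _.
  by rewrite lee_fin -[leLHS](powRr0 y) ler_powR ?(ltW y_gt1) ?divr_ge0.
have ln2_gt0 : 0 < ln 2 :> R by rewrite ln_gt0 // ltr1n.
pose L := ln phi / ln 2.
have L1 : 1 <= L by rewrite /L ler_pdivlMr // mul1r ler_ln // ?posrE.
have pow2L : 2 `^ L = phi.
  by rewrite /powR pnatr_eq0 /= /L divfK ?gt_eqF // lnK.
rewrite -/L.
(* t = 6 log2 (32 phi) is where the tail bound starts to be nontrivial. *)
pose t := 6 * (L + 5).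
(* The ratio 11/12 is a rational upper bound for [2 ^ (-1/6)]. The total [6 * L + 30 + 12] is at
   most [18 * L + 30] because [L >= 1]. *)
apply: (@le_trans _ _ (t + (1 - 11 / 12)^-1)%:E); last first.
  rewrite lee_fin (_ : 1 - 11 / 12 = 12^-1); last by lra.
  by rewrite invrK /t; lra.
have t_ge0 : 0 <= t by rewrite /t; lra.
apply: geometric_tail_expectation => //.
- exact: measurable_worst_ratio.
- by move=> w; apply: worst_ratio_ge0.
- by apply/andP; split; lra.
(* For [n = 0] the tail bound has exponent 0 and says nothing, but the ratio is then 0 and below
   [t]. *)
move=> k; have [n0|n_gt0] := posnP n.
  rewrite (_ : [set _ | _] = set0).
    by rewrite measure0 lee_fin exprn_ge0 //; lra.
  apply/seteqP; split=> // w /=; rewrite worst_ratio_no_job // leNgt.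
  by rewrite ltr_wpDr // /t; lra.
pose v : R := 2 `^ 6^-1.
have v_gt0 : 0 < v by apply: powR_gt0.
have v_ge : 12 / 11 <= v.
  rewrite -(@ler_pXn2r _ 6) ?nnegrE ?(ltW v_gt0) //.
  rewrite -[leRHS]powR_mulrn ?(ltW v_gt0) // -powRrM mulVf // powRr1 //; lra.
have yE : 32 * phi / 2 `^ ((t + k%:R) / 6) = v^-1 ^+ k.
  rewrite (_ : (t + k%:R) / 6 = L + (5 + 6^-1 * k%:R)); last by rewrite /t; lra.
  have nz b : b ==> (2 != 0 :> R) by rewrite pnatr_eq0 implybT.
  rewrite powRD ?nz // powRD ?nz // pow2L [2 `^ (6^-1 * _)]powRrM.
  rewrite !powR_mulrn ?(ltW v_gt0) // ?ler0n // -/v exprVn mulrA.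
  rewrite (_ : 2 ^+ 5 = 32); last by rewrite -natrX.
  rewrite [32 * _]mulrC invfM mulrA divff ?mul1r // mulf_neq0 //.
  by rewrite gt_eqF.
have q_ge0 : 0 <= v^-1 by rewrite invr_ge0 ltW.
have q_le : v^-1 <= 11 / 12.
  by rewrite -[leRHS]invrK lef_pV2 ?posrE //; lra.
have y_le1 : 32 * phi / 2 `^ ((t + k%:R) / 6) <= 1.
  by rewrite yE exprn_ile1 // (le_trans q_le) //; lra.
have tk0 : 0 <= t + k%:R by rewrite addr_ge0.
apply: le_trans (worst_ratio_tail _ _ _ hphi hp _ tk0 y_le1) _.
rewrite lee_fin; apply: (@le_trans _ _ (v^-1 ^+ k)); last first.
  by rewrite lerXn2r // nnegrE; lra.
(* With at least one job the exponent is at least 1, so the power is at most its base. *)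
rewrite -yE -[leRHS]expr1 ler_wiXn2l //; last by rewrite uphalf_gt0.
by rewrite yE exprn_ge0.
Qed.
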